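(* Let $\mathbb A$ be an algebra on $\mathbb R^n$, let $k\in\{2,\dots,n\}$, let $U\subset\mathbb R^k$ be an open set, and let $f,\varphi:U\to\mathbb R^n$ be differentiable in the usual sense. Suppose that $\varphi$ has an $\mathbb A$-regular direction on $U$. If the components of $f$ satisfy the $\varphi\mathbb A$-Cauchy-Riemann equations $d\varphi(e_j)\,f_{u_i}=d\varphi(e_i)\,f_{u_j}$ on $U$ for all $i,j\in\{1,\dots,k\}$, then $f$ is $\varphi\mathbb A$-differentiable.
   Context: An algebra $\mathbb A$ on $\mathbb R^n$ is the real linear space $\mathbb R^n$ with a bilinear, associative, commutative product having a unit $e$; an element $a\in\mathbb A$ is regular if it has an inverse $a^{-1}$ with $a^{-1}a=e$. For $f,\varphi:U\subset\mathbb R^k\to\mathbb R^n$ differentiable in the usual sense, $f$ is $\varphi\mathbb A$-differentiable on $U$ if there is a function $f'_\varphi:U\to\mathbb R^n$ such that $df_u(\xi)=f'_\varphi(u)\,d\varphi_u(\xi)$ ($\mathbb A$-product) for all $u\in U$, $\xi\in\mathbb R^k$. The function $\varphi$ has an $\mathbb A$-regular direction $\xi$ on $U$ if $\xi$ is a function $u\mapsto\xi_u$ from $U$ to the unit sphere of $\mathbb R^k$ centered at the origin such that $d\varphi_u(\xi_u)$ is a regular element of $\mathbb A$ for all $u\in U$. Here $f_{u_i}$ is the partial derivative of $f$ with respect to the $i$-th coordinate of $\mathbb R^k$, $d\varphi(e_i)$ is the usual differential of $\varphi$ applied to the $i$-th canonical vector of $\mathbb R^k$, and products are $\mathbb A$-products.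 *)

(* Defs.v *)
(* The field of real numbers is an arbitrary [R : realType]. *)
From mathcomp Require Export all_boot all_order all_algebra sesquilinear.
From mathcomp Require Export all_classical all_reals all_analysis.
Export numFieldNormedType.Exports.

Set Implicit Arguments.
Unset Strict Implicit.
Unset Printing Implicit Defensive.

Import GRing.Theory Num.Theory.
Local Open Scope ring_scope.
Local Open Scope classical_set_scope.

Record algebra (R : realType) (n : nat) := Algebra {
  amul : {bilinear 'rV[R]_n -> 'rV[R]_n -> 'rV[R]_n};
  aunit : 'rV[R]_n;
  amulA : associative amul;
  amulC : commutative amul;
  amul1 : left_id aunit amul }.

Definition regular (R : realType) (n : nat) (A : algebra R n) (a : 'rV[R]_n) :=
  exists b : 'rV[R]_n, amul A b a = aunit A.

(* The norm of the library on ['rV[R]_k] is the sup norm, hence the explicit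
   Euclidean norm here. *)
Definition unit_sphere (R : realType) (k : nat) : set 'rV[R]_k :=
  [set x | Num.sqrt (\sum_(i < k) x 0 i ^+ 2) = 1].

Definition basis_vec (R : realType) (k : nat) (i : 'I_k) : 'rV[R]_k :=
  delta_mx 0 i.

(* Functions on an open set [U] are represented by total functions of which
   only the values on [U] matter. The differentials are meaningful under the
   assumption that [f] and [phi] are differentiable on [U]. *)
Definition differentiable_on (R : realType) (k n : nat) (U : set 'rV[R]_k)
    (f : 'rV[R]_k -> 'rV[R]_n) :=
  forall u, U u -> differentiable f u.

Definition phiA_differentiable_on (R : realType) (k n : nat) (A : algebra R n)
    (U : set 'rV[R]_k) (phi f : 'rV[R]_k -> 'rV[R]_n) :=
  exists f' : 'rV[R]_k -> 'rV[R]_n,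
    forall u, U u -> forall xi : 'rV[R]_k,
      'd f u xi = amul A (f' u) ('d phi u xi).

Definition regular_direction (R : realType) (k n : nat) (A : algebra R n)
    (U : set 'rV[R]_k) (phi : 'rV[R]_k -> 'rV[R]_n)
    (xi : 'rV[R]_k -> 'rV[R]_k) :=
  forall u, U u -> @unit_sphere R k (xi u) /\ regular A ('d phi u (xi u)).

Definition has_regular_direction (R : realType) (k n : nat) (A : algebra R n)
    (U : set 'rV[R]_k) (phi : 'rV[R]_k -> 'rV[R]_n) :=
  exists xi : 'rV[R]_k -> 'rV[R]_k, regular_direction A U phi xi.

Definition partial (R : realType) (k n : nat) (i : 'I_k)
    (f : 'rV[R]_k -> 'rV[R]_n) (u : 'rV[R]_k) : 'rV[R]_n :=
  'D_(basis_vec R i) f u.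

Definition cauchy_riemann_on (R : realType) (k n : nat) (A : algebra R n)
    (U : set 'rV[R]_k) (phi f : 'rV[R]_k -> 'rV[R]_n) :=
  forall u, U u -> forall i j : 'I_k,
    amul A ('d phi u (basis_vec R j)) (partial i f u) =
    amul A ('d phi u (basis_vec R i)) (partial j f u).

(* Main.v *)
Require Import Defs.
Import GRing.Theory.
Local Open Scope ring_scope.
Local Open Scope classical_set_scope.

(** The Cauchy-Riemann equations say that the bilinear map
    [(x, y) |-> dphi(y) df(x) - dphi(x) df(y)] vanishes on basis vectors, hence
    everywhere.  Taking for [y] the regular direction [xi] and multiplying by
    the inverse [b] of [dphi(xi)] gives [df(x) = (b df(xi)) dphi(x)]. *)

(** Meant for [B] the product of the algebra and [h], [g] the differentials of [phi], [f] at a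
    point. *)
Lemma bilinear_symmetric_basis (R : comNzRingType) (k : nat)
    (V W Z : lmodType R) (B : {bilinear V -> W -> Z})
    (h : {linear 'rV[R]_k -> V}) (g : {linear 'rV[R]_k -> W}) :
  (forall i j, B (h (delta_mx 0 j)) (g (delta_mx 0 i)) =
               B (h (delta_mx 0 i)) (g (delta_mx 0 j))) ->
  forall x y, B (h y) (g x) = B (h x) (g y).
Proof.
have expand x y : B (h y) (g x) =
    \sum_i \sum_j (y 0 i * x 0 j) *: B (h (delta_mx 0 i)) (g (delta_mx 0 j)).
  rewrite {1}(row_sum_delta y) linear_sum linear_sumlz.
  apply: eq_bigr => i _.
  rewrite {1}(row_sum_delta x) linear_sum linear_sumr.
  apply: eq_bigr => j _.
  by rewrite (linearZ_LR h) (linearZ_LR g) linearZl_LR linearZr_LR scalerA.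
(* Swapping the sums exchanges the roles of the indices, so [sym] matches the two expansions term by
   term. *)
move=> sym x y; rewrite !expand exchange_big.
apply: eq_bigr => i _; apply: eq_bigr => j _.
by rewrite sym mulrC.
Qed.

Theorem theorem1p2 (R : realType) (n k : nat) (A : algebra R n)
    (hk : (2 <= k <= n)%N) (U : set 'rV[R]_k) (hU : open U)
    (f phi : 'rV[R]_k -> 'rV[R]_n)
    (hf : differentiable_on U f) (hphi : differentiable_on U phi)
    (hreg : has_regular_direction A U phi)
    (hCR : cauchy_riemann_on A U phi f) :
  phiA_differentiable_on A U phi f.
Proof.
case: hreg => xi hxi.
(* Choice glues pointwise values [a] into [f']; off [U] any value will do. *)
suff /choice[f' hf'] : forall u, exists a, U u ->
    forall x, 'd f u x = amul A a ('d phi u x) by exists f' => u /hf'.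
move=> u; have [Uu|nUu] := pselect (U u); last by exists 0.
have [_ [b bK]] := hxi u Uu.
exists (amul A b ('d f u (xi u))) => _ x.
have sym : forall x y, amul A ('d phi u y) ('d f u x) =
                       amul A ('d phi u x) ('d f u y).
  apply: bilinear_symmetric_basis => i j.
  (* Differentiability of [f] at [u] turns its partial derivatives into values of ['d f u] on basis
     vectors. *)
  by have := hCR u Uu i j; rewrite /partial !deriveE //; exact: hf.
by rewrite -amulA [X in amul A b X]amulC -sym amulA bK amul1.
Qed.
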